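(* Let $n,m,k$ be integers with $2\le m\le n$ and $2\le k\le 2^{m-1}+1$. Then $$v_2\big(s(2^n,2^m-k)\big)=2^n-2^m-(n-m)\Big(2^m-2\Big\lfloor\frac{k}{2}\Big\rfloor\Big)+m-2-v_2\Big(\Big\lfloor\frac{k}{2}\Big\rfloor\Big)+(n-1)\epsilon_k,$$ where $\epsilon_k=0$ if $k$ is even and $\epsilon_k=1$ if $k$ is odd.
   Context: For nonnegative integers $n$, the Pochhammer symbol is $(x)_n=x(x+1)\cdots(x+n-1)$ (with $(x)_0=1$). The (unsigned) Stirling numbers of the first kind $s(n,k)$ are defined by $(x)_n=\sum_{k=0}^n s(n,k)x^k$, and $s(n,k)=0$ for $k>n$. For a nonzero rational $x=n_1/n_2$, $v_2(x)=v_2(n_1)-v_2(n_2)$, where $v_2$ of a nonzero integer is the exponent of the largest power of $2$ dividing it. $\lfloor y\rfloor$ is the floor of $y$. *)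

(* Defs.v *)
From HB Require Import structures.
From mathcomp Require Import all_boot all_order all_algebra.
Set Implicit Arguments. Unset Strict Implicit. Unset Printing Implicit Defensive.
Import Order.TTheory GRing.Theory Num.Theory.
Local Open Scope ring_scope.

Definition pochhammer (n : nat) : {poly int} :=
  \prod_(i < n) ('X + (i%:Z)%:P).

(* unsigned Stirling numbers of the first kind: (x)_n = sum_k s(n,k) x^k *)
Definition stirling1 (n k : nat) : int := (pochhammer n)`_k.

Definition v2 (z : int) : nat := logn 2 `|z|%N.

(* Main.v *)
Require Import Defs.
From HB Require Import structures.
From mathcomp Require Import all_boot all_order all_algebra.
From mathcomp Require Import zify ring.
Import Order.TTheory GRing.Theory Num.Theory.
Local Open Scope ring_scope.

(** Write [P_n] for [(x)_{2^n}] and [d = n - m].  From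
    [P_{n+1}(x) = P_n(x) P_n(x + 2^n)] one gets, by induction first on [d] and
    then on [m], [P_n(2^d y) = 2^(2^n - 2^m) W(y)] where [W] has integer
    coefficients and [W = (y^2 + y)^(2^(m-1))] modulo [2^(m-1)]: a congruence
    modulo [2^j], [j >= 1], improves to one modulo [2^(j+1)] when squared.
    Hence the coefficient of [y^(2^m - k)] in [W] is [C(2^(m-1), k)] modulo
    [2^(m-1)], whose 2-adic valuation is [m - 1 - v_2(k)]; for even [k] this is
    small enough to be read off modulo [2^(m-1)].

    For odd [k], the reflection [i -> 2^n - i] of the nonzero roots says that
    [V(y) = W(y) / y] satisfies [V(-y) = - V(y - 2^m)].  Expanding the right
    side to second order, the coefficients satisfy
    [W_j = 2^(m-1) j W_(j+1)] modulo [2^(2m-1)] for odd [j], which reduces [k]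
    to [k - 1]. *)

(** * Doubling and rescaling of the Pochhammer polynomial *)

Lemma comp_poly_taylor2 (p c : {poly int}) :
  exists r, p \Po ('X + c) = p + c * p^`() + c ^+ 2 * r.
Proof.
elim/poly_ind: p => [|p a [r IH]].
  by exists 0; rewrite comp_poly0 deriv0 !mulr0 !addr0.
exists (r * 'X + p^`() + c * r).
rewrite comp_polyD comp_polyM comp_polyX comp_polyC IH.
rewrite derivD derivM derivX derivC; ring.
Qed.

Lemma comp_poly_nat (k : nat) (q : {poly int}) : k%:R \Po q = k%:R.
Proof. exact: rmorph_nat. Qed.

Lemma comp_polyXn_nat (k i : nat) (q : {poly int}) :
  (k%:R ^+ i) \Po q = k%:R ^+ i.
Proof. by rewrite rmorphXn /= comp_poly_nat. Qed.

Lemma pochhammer_pow2S (n : nat) :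
  pochhammer (2 ^ n.+1) =
  pochhammer (2 ^ n) * (pochhammer (2 ^ n) \Po ('X + 2 ^+ n)).
Proof.
rewrite expnS mul2n -addnn /pochhammer big_split_ord /= rmorph_prod /=.
congr (_ * _); apply: eq_bigr => i _.
rewrite comp_polyD comp_polyX comp_polyC -!addrA; congr (_ + _).
by rewrite PoszD polyCD -natz raddfMn /= natrX.
Qed.

(** In the rescaled variable the shift by [2 ^ (d + n)] becomes a shift by [2 ^ n], so [d] can stay
    fixed while [n] grows. *)
Lemma pochhammer_pow2_scaled_double (d n : nat) :
  pochhammer (2 ^ (d + n).+1) \Po (2 ^+ d * 'X) =
  (pochhammer (2 ^ (d + n)) \Po (2 ^+ d * 'X)) *
  ((pochhammer (2 ^ (d + n)) \Po (2 ^+ d * 'X)) \Po ('X + 2 ^+ n)).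
Proof.
rewrite pochhammer_pow2S comp_polyM; congr (_ * _).
rewrite -!comp_polyA; congr (_ \Po _).
rewrite comp_polyD comp_polyM comp_polyX !comp_polyXn_nat comp_polyX exprD; ring.
Qed.

(** Each step on [d] substitutes [2 * 'X] in one factor, which yields the extra power of 2, and
    [2 * 'X + 1] in the other, which is 1 modulo 2. *)
Lemma pochhammer_pow2_scaled0 (d : nat) :
  exists H : {poly int},
  pochhammer (2 ^ d) \Po (2 ^+ d * 'X) = 2 ^+ (2 ^ d).-1 * ('X * (1 + 2 * H)).
Proof.
elim: d => [|d [H IH]].
  exists 0; rewrite /pochhammer big_ord1 comp_polyD comp_polyX comp_polyC /=.
  by rewrite !expr0 polyC0; ring.
exists ((H \Po (2 * 'X)) * (2 * 'X + 1) * (1 + 2 * (H \Po (2 * 'X + 1)))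
        + 'X * (1 + 2 * (H \Po (2 * 'X + 1))) + (H \Po (2 * 'X + 1))).
have -> : pochhammer (2 ^ d.+1) \Po (2 ^+ d.+1 * 'X) =
  ((pochhammer (2 ^ d) \Po (2 ^+ d * 'X)) \Po (2 * 'X)) *
  ((pochhammer (2 ^ d) \Po (2 ^+ d * 'X)) \Po (2 * 'X + 1)).
  rewrite pochhammer_pow2S comp_polyM -!comp_polyA.
  congr ((_ \Po _) * (_ \Po _));
    by rewrite !(comp_polyD, comp_polyM, comp_polyX, comp_polyXn_nat) exprS; ring.
rewrite IH !(comp_polyD, comp_polyM, comp_polyX, comp_polyXn_nat, comp_poly_nat).
have -> : (2 ^ d.+1).-1 = ((2 ^ d).-1 + (2 ^ d).-1).+1.
  by rewrite expnS; have := expn_gt0 2 d; lia.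
have c1 q : (1 : {poly int}) \Po q = 1 by exact: comp_polyC.
rewrite !c1 [in RHS]exprS exprD; ring.
Qed.

Lemma pochhammer_pow2_scaled1 (d : nat) :
  exists G : {poly int},
  pochhammer (2 ^ d.+1) \Po (2 ^+ d * 'X) =
  2 ^+ (2 * (2 ^ d).-1) * ('X ^+ 2 + 'X + 2 * G).
Proof.
have [H WE] := pochhammer_pow2_scaled0 d.
have := pochhammer_pow2_scaled_double d 0; rewrite addn0 => ->.
rewrite WE !(comp_polyD, comp_polyM, comp_polyX, comp_polyXn_nat, comp_poly_nat).
have c1 q : (1 : {poly int}) \Po q = 1 by exact: comp_polyC.
set H1 := H \Po _; rewrite !c1 mul2n -addnn exprD expr0.
exists ('X * ('X + 1) * (H + H1 + 2 * H * H1)); ring.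
Qed.

Lemma pochhammer_pow2_scaled (d m : nat) :
  exists G : {poly int},
  pochhammer (2 ^ (d + m.+2)) \Po (2 ^+ d * 'X) =
  2 ^+ (2 ^ m.+2 * (2 ^ d).-1) *
  (('X ^+ 2 + 'X) ^+ (2 ^ m.+1) + 2 ^+ m.+1 * G).
Proof.
elim: m => [|m [G IH]]; rewrite addnS pochhammer_pow2_scaled_double.
  (* The shift is only 2 here, so its Taylor term is merely even: this first doubling stays modulo
     2, although squaring alone would reach 4. *)
  rewrite addn1; have [G ->] := pochhammer_pow2_scaled1 d.
  rewrite comp_polyM comp_polyXn_nat.
  set W := 'X ^+ 2 + 'X + 2 * G.
  have [r ->] := comp_poly_taylor2 W (2 ^+ 1).
  exists (2 * G * ('X ^+ 2 + 'X) + 2 * G ^+ 2 + W * (W^`() + 2 * r)).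
  rewrite (_ : 2 ^ 2 * _ = 2 * (2 ^ d).-1 + 2 * (2 ^ d).-1)%N; last by lia.
  by rewrite exprD /W expn1 expr1; ring.
rewrite IH comp_polyM comp_polyXn_nat.
set Z := _ ^+ (2 ^ m.+1); set W := Z + _.
(* Now the shift is as divisible by 2 as the cross term of [W ^+ 2], so each doubling gains one
   power of 2. *)
have [r ->] := comp_poly_taylor2 W (2 ^+ m.+2).
exists (Z * G + 2 ^+ m * G ^+ 2 + W * (W^`() + 2 ^+ m.+2 * r)).
rewrite [(2 ^ m.+3)%N]expnS -mulnA mul2n -addnn exprD.
rewrite [(2 ^ m.+2)%N in X in _ ^+ X + _]expnS mul2n -addnn exprD -/Z.
by rewrite /W !exprS; ring.
Qed.

(** * Reflection of the roots *)

Lemma coef_comp_scaleX (R : comNzRingType) (p : {poly R}) (a : R) (j : nat) :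
  (p \Po (a%:P * 'X))`_j = a ^+ j * p`_j.
Proof.
elim/poly_ind: p j => [|p c IH] j; first by rewrite comp_poly0 coef0 mulr0.
rewrite comp_polyD comp_polyM comp_polyX comp_polyC mulrCA.
rewrite !(coefD, coefCM, coefMX, coefC).
case: j => [|j] /=; first by rewrite mulr0 expr0 mul1r.
by rewrite IH !addr0 exprS mulrA.
Qed.

(** Both sides are the product of ['X - i] over [0 <= i <= N]; evenness of [N] removes the sign. *)
Lemma pochhammer_reflect (N : nat) : ~~ odd N ->
  (pochhammer N \Po - 'X) * ('X - N%:R) = 'X * (pochhammer N \Po ('X - N%:R)).
Proof.
move=> evenN; pose F (i : nat) : {poly int} := 'X - i%:R.
have cast i : ((i%:Z)%:P : {poly int}) = i%:R.
  by rewrite -natz raddfMn.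
have -> : pochhammer N \Po - 'X = \prod_(i < N) F i.
  rewrite /pochhammer rmorph_prod /=.
  transitivity (\prod_(i < N) - F i); last first.
    by rewrite prodrN card_ord -signr_odd (negbTE evenN) mul1r.
  apply: eq_bigr => i _.
  by rewrite comp_polyD comp_polyX comp_polyC cast /F opprB addrC.
have -> : pochhammer N \Po ('X - N%:R) = \prod_(i < N) F i.+1.
  rewrite /pochhammer rmorph_prod /= (reindex_inj rev_ord_inj) /=.
  apply: eq_bigr => i _.
  rewrite comp_polyD comp_polyX comp_polyC cast /F natrB ?ltn_ord //; ring.
have <- : \prod_(i < N.+1) F i = (\prod_(i < N) F i) * F N by rewrite big_ord_recr.
by rewrite big_ord_recl /= {1}/F subr0.
Qed.

(** For the quotient [V] of [W] by ['X], the two sides of the reflection carry [V_j] with opposite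
    signs when [j] is even, so it doubles instead of cancelling. *)
Lemma reflect_coef (W : {poly int}) (c : int) : c != 0 ->
  (W \Po - 'X) * ('X - c%:P) = 'X * (W \Po ('X - c%:P)) ->
  exists U : {poly int}, forall j, ~~ odd j ->
    2 * W`_j.+1 = c * j.+1%:R * W`_j.+2 - c ^+ 2 * U`_j.
Proof.
move=> cN0 reflW.
have /factor_theorem [V WE] : root W 0.
  have /(congr1 (fun p => p.[0])) := reflW.
  rewrite !hornerM !horner_comp !hornerE => /eqP.
  by rewrite mulf_eq0 oppr_eq0 (negbTE cN0) orbF oppr0.
rewrite subr0 in WE.
have reflV : V \Po - 'X = - (V \Po ('X - c%:P)).
  have nz : 'X * ('X - c%:P) != 0 :> {poly int}.
    by rewrite mulf_neq0 ?polyX_eq0 ?polyXsubC_eq0.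
  apply: (mulIf nz); move: reflW; rewrite WE !comp_polyM !comp_polyX => E.
  by rewrite mulNr [in RHS]mulrCA -E; ring.
have [r] := comp_poly_taylor2 V (- c%:P); rewrite sqrrN => taylorV.
exists r => j evenj; rewrite WE !coefMX /=.
have := congr1 (fun p : {poly int} => p`_j) reflV.
rewrite taylorV (_ : - 'X = (-1)%:P * 'X); last by rewrite polyCN mulN1r.
rewrite coef_comp_scaleX -signr_odd (negbTE evenj) expr0 mul1r.
rewrite coefN !coefD -polyCN -polyC_exp !coefCM coef_deriv -mulr_natr => E.
have -> : 2 * V`_j = V`_j + V`_j by ring.
by rewrite {2}E; ring.
Qed.

(** * Binomial coefficients and 2-adic valuations *)

Lemma coef_XXp1_exp (M k : nat) : (k <= M)%N ->
  (('X ^+ 2 + 'X : {poly int}) ^+ M)`_(M.*2 - k) = 'C(M, k)%:R.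
Proof.
move=> lekM.
rewrite (_ : 'X ^+ 2 + 'X = 'X * ('X + 1)) ?exprMn; last by ring.
rewrite coefXnM ifF; last by lia.
rewrite exprD1n (_ : (M.*2 - k - M = M - k)%N); last by lia.
rewrite coef_sum (bigD1 (inord (M - k))) //=.
rewrite inordK; last by lia.
rewrite coefMn coefXn eqxx bin_sub // big1 ?addr0 // => i /eqP neq_i.
rewrite coefMn coefXn; case: eqP => [E|]; last by rewrite mul0rn.
by case: neq_i; apply: val_inj; rewrite /= inordK; lia.
Qed.

(** Take valuations in [k * 'C(2 ^ M, k) = 2 ^ M * 'C(2 ^ M - 1, k - 1)], whose last factor is
    odd. *)
Lemma logn2_bin_pow2 (M k : nat) : (0 < k <= 2 ^ M)%N ->
  (logn 2 'C(2 ^ M, k) + logn 2 k)%N = M.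
Proof.
have pos : (0 < 2 ^ M)%N by rewrite expn_gt0.
have logE j : (j < 2 ^ M)%N ->
    (M + logn 2 'C((2 ^ M).-1, j) = logn 2 j.+1 + logn 2 'C(2 ^ M, j.+1))%N.
  move=> ltj; rewrite -lognM ?bin_gt0 // -mul_bin_diag lognM ?bin_gt0 //; last by lia.
  by rewrite pfactorK.
(* By Pascal's rule, neighbours in row [2 ^ M - 1] add up to ['C(2 ^ M, j.+1)], which is even by
   [logE]; so they share their parity. *)
have odd_bin j : (j < 2 ^ M)%N -> odd 'C((2 ^ M).-1, j).
  elim: j => [|j IH] ltj; first by rewrite bin0.
  have ltj' := ltnW ltj.
  have : ~~ odd 'C(2 ^ M, j.+1).
    have Cpos : (0 < 'C(2 ^ M, j.+1))%N by rewrite bin_gt0.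
    have ltlog : (logn 2 j.+1 < M)%N.
      by rewrite -(ltn_exp2l _ _ (isT : 1 < 2)%N) (leq_ltn_trans _ ltj) //
                 dvdn_leq // pfactor_dvdnn.
    have := @pfactor_dvdn 2 1 _ isT Cpos; rewrite expn1 -dvdn2 => ->.
    by have := logE j ltj'; lia.
  by rewrite -(prednK pos) binS oddD IH // addbT negbK.
case: k => // j /andP[_ ltj].
have := logE j ltj; rewrite (@logn_coprime 2 'C(_, j)) ?coprime2n ?odd_bin //.
by lia.
Qed.

Lemma v2M (a b : int) : a != 0 -> b != 0 -> v2 (a * b) = (v2 a + v2 b)%N.
Proof. by move=> a0 b0; rewrite /v2 abszM lognM ?absz_gt0. Qed.

Lemma v2_exp2 (e : nat) : v2 (2 ^+ e) = e.
Proof. by rewrite /v2 abszX pfactorK. Qed.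

Lemma dvdz_exp2_v2 (e : nat) (a : int) : a != 0 ->
  (2 ^+ e %| a)%Z = (e <= v2 a)%N.
Proof. by move=> a0; rewrite dvdzE abszX pfactor_dvdn ?absz_gt0. Qed.

(** Nonvanishing is concluded too, since [v2 0] is 0 by default and equal valuations would not imply
    it. *)
Lemma v2_add_exp2 (a b : int) (e : nat) : a != 0 -> (v2 a < e)%N ->
  a + 2 ^+ e * b != 0 /\ v2 (a + 2 ^+ e * b) = v2 a.
Proof.
move=> a0 lta.
have dvdE f : (f <= e)%N -> (2 ^+ f %| a + 2 ^+ e * b)%Z = (2 ^+ f %| a)%Z.
  move=> lef; rewrite rpredDr //; apply: dvdz_mulr.
  by rewrite -(subnKC lef) exprD dvdz_mulr.
have s0 : a + 2 ^+ e * b != 0.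
  apply/eqP => s0; have := dvdE e (leqnn _).
  by rewrite s0 dvdz0 dvdz_exp2_v2 // leqNgt lta.
split=> //; apply/eqP; rewrite eqn_leq; apply/andP; split.
  by rewrite leqNgt -dvdz_exp2_v2 // dvdE // dvdz_exp2_v2 // ltnn.
by rewrite -dvdz_exp2_v2 // dvdE ?(ltnW lta) // dvdz_exp2_v2.
Qed.

(** * Coefficient relations for the rescaled polynomial *)

Lemma pochhammer_scaled_reflect (d m B : nat) (W : {poly int}) : (0 < m)%N ->
  pochhammer (2 ^ (d + m)) \Po (2 ^+ d * 'X) = 2 ^+ B * W ->
  (W \Po - 'X) * ('X - (2 ^+ m)%:P) = 'X * (W \Po ('X - (2 ^+ m)%:P)).
Proof.
move=> m0 PE.
have exp2N0 e : 2 ^+ e != 0 :> {poly int} by rewrite expf_neq0 // -polyC_natr polyC_eq0.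
have compW q : 2 ^+ B * (W \Po q) = pochhammer (2 ^ (d + m)) \Po (2 ^+ d * q).
  have /(congr1 (comp_poly q)) := PE.
  by rewrite -comp_polyA !comp_polyM !comp_polyXn_nat comp_polyX => <-.
have cast : (2 ^+ m)%:P = 2 ^+ m :> {poly int} by rewrite rmorphXn /= polyC_natr.
have even2 : ~~ odd (2 ^ (d + m)) by rewrite oddX; lia.
(* At [x = 2 ^ d * y], [x - 2 ^ (d + m)] is [2 ^ d * (y - 2 ^ m)]; the common factors [2 ^ B] and
   [2 ^ d] cancel below. *)
have /(congr1 (comp_poly (2 ^+ d * 'X))) := pochhammer_reflect _ even2.
rewrite !comp_polyM -!comp_polyA !rmorphB !rmorphN /= !comp_polyX comp_poly_nat.
rewrite natrX exprD cast => E.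
apply: (mulfI (exp2N0 B)); apply: (mulfI (exp2N0 d)).
rewrite mulrA [RHS]mulrCA [X in _ = _ * X]mulrCA.
have := compW (- 'X); have := compW ('X - 2 ^+ m).
rewrite mulrN mulrBr => E1 E2; rewrite -E1 -E2 in E.
by rewrite -mulrA [LHS](_ : _ = 2 ^+ B * (W \Po - 'X) * (2 ^+ d * 'X - 2 ^+ d * 2 ^+ m));
   [rewrite E | ]; ring.
Qed.

(** Collects what the valuation argument needs from [W]; [m.+2] stands for the [m] of the
    theorem. *)
Lemma stirling1_pow2_scaled (d m : nat) : exists W : {poly int},
  [/\ forall j, 2 ^+ (d * j) * stirling1 (2 ^ (d + m.+2)) j =
                2 ^+ (2 ^ m.+2 * (2 ^ d).-1) * W`_j,
      forall k, (k <= 2 ^ m.+1)%N -> exists g : int,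
        W`_(2 ^ m.+2 - k) = 'C(2 ^ m.+1, k)%:R + 2 ^+ m.+1 * g
    & forall j, ~~ odd j -> exists u : int,
        W`_j.+1 = 2 ^+ m.+1 * j.+1%:R * W`_j.+2 + 2 ^+ (m.+2 + m.+1) * u].
Proof.
have [G PE] := pochhammer_pow2_scaled d m.
set W := _ + _ in PE; exists W.
have cast e : 2 ^+ e = (2 ^+ e)%:P :> {poly int} by rewrite rmorphXn /= polyC_natr.
split.
- move=> j; have /(congr1 (fun p : {poly int} => p`_j)) := PE.
  by rewrite !cast coef_comp_scaleX coefCM -exprM.
- move=> k lek; exists G`_(2 ^ m.+2 - k).
  rewrite /W coefD cast coefCM; congr (_ + _).
  by rewrite [(2 ^ m.+2)%N]expnS mul2n coef_XXp1_exp.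
- move=> j evenj.
  have c0 : (2 ^+ m.+2 : int) != 0 by rewrite expf_neq0.
  have [U /(_ j evenj) E] := reflect_coef _ _ c0 (pochhammer_scaled_reflect _ _ _ _ (ltn0Sn _) PE).
  (* Halving the relation for [c = 2 ^ m.+2] lowers the exponents [m + 2] and [2m + 4] by one. *)
  exists (- U`_j); apply: (@mulfI _ (2 : int)) => //.
  by rewrite E exprD !exprS; ring.
Qed.

Lemma v2_stirling1_scaled (d m j : nat) (W : {poly int}) :
  2 ^+ (d * j) * stirling1 (2 ^ (d + m)) j =
    2 ^+ (2 ^ m * (2 ^ d).-1) * W`_j ->
  W`_j != 0 ->
  (d * j + v2 (stirling1 (2 ^ (d + m)) j))%N = (2 ^ m * (2 ^ d).-1 + v2 W`_j)%N.
Proof.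
move=> E W0; have exp2N0 e : (2 ^+ e : int) != 0 by rewrite expf_neq0.
have s0 : stirling1 (2 ^ (d + m)) j != 0.
  by have := mulf_neq0 (exp2N0 (2 ^ m * (2 ^ d).-1)%N) W0; rewrite -E mulf_eq0 => /norP[].
by have := congr1 v2 E; rewrite !v2M // !v2_exp2.
Qed.

Theorem theorem1p1 (n m k : nat) :
  (2 <= m)%N -> (m <= n)%N -> (2 <= k)%N -> (k <= 2 ^ m.-1 + 1)%N ->
  ((v2 (stirling1 (2 ^ n) (2 ^ m - k)))%:Z : int) =
    (2 ^ n)%:Z - (2 ^ m)%:Z
    - ((n - m)%:Z) * ((2 ^ m)%:Z - 2 * (k./2)%:Z)
    + m%:Z - 2 - (v2 (k./2)%:Z)%:Z
    + (n.-1)%:Z * (odd k)%:Z.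
Proof.
case: m => [|[|m]] // _ lemn le2k lek; rewrite /= in lek.
have [d nE] : exists d, n = (d + m.+2)%N by exists (n - m.+2)%N; rewrite subnK.
rewrite {lemn}nE addnK.
have [W [scaleW coefW oddW]] := stirling1_pow2_scaled d m.
have exp2S : (2 ^ m.+2 = 2 * 2 ^ m.+1)%N by rewrite expnS.
have evenW h : (0 < h)%N -> (h.*2 <= 2 ^ m.+1)%N ->
    W`_(2 ^ m.+2 - h.*2) != 0 /\ (v2 W`_(2 ^ m.+2 - h.*2) + v2 h%:Z)%N = m.
  move=> h0 leh; have [g ->] := coefW _ leh.
  have C0 : 'C(2 ^ m.+1, h.*2)%:R != 0 :> int.
    by rewrite pnatr_eq0 -lt0n bin_gt0.
  have vC : (v2 'C(2 ^ m.+1, h.*2)%:R + v2 h%:Z)%N = m.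
    have := logn2_bin_pow2 m.+1 h.*2; rewrite double_gt0 h0 leh => /(_ isT).
    rewrite -[X in (_ + logn 2 X)%N]mul2n lognM // (@logn_prime 2 2 isT) /v2 natz !absz_nat.
    by rewrite addnCA add1n => -[].
  (* The binomial has valuation at most [m], so the error term [2 ^ m.+1 * g] cannot change it. *)
  have ltC : (v2 'C(2 ^ m.+1, h.*2)%:R < m.+1)%N by rewrite ltnS -{2}vC leq_addr.
  by have [-> ->] := v2_add_exp2 _ g m.+1 C0 ltC.
have valS j := v2_stirling1_scaled d m.+2 j W (scaleW j).
have BE : (2 ^ m.+2 * (2 ^ d).-1 + 2 ^ m.+2 = 2 ^ (d + m.+2))%N.
  by rewrite expnD -mulnSr prednK ?expn_gt0 // mulnC.
have kE := odd_double_half k; move: kE; set h := k./2 => kE.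
have h0 : (0 < h)%N by lia.
have leh : (h.*2 <= 2 ^ m.+1)%N.
  (* An even [k] cannot equal the odd bound [2 ^ m.+1 + 1]; an odd [k] exceeds [h.*2] by one. *)
  have : ~~ odd (2 ^ m.+1) by rewrite oddX.
  lia.
have [W0 vW] := evenW _ h0 leh.
have leh2 : (h.*2 <= 2 ^ m.+2)%N by rewrite exp2S; lia.
case: (odd k) kE => kE; last first.
  have := valS _ W0; rewrite -kE add0n.
  move: (2 ^ m.+2 * _)%N (2 ^ (d + _))%N BE (2 ^ m.+2 - h.*2)%N (subnK leh2) vW.
  by move=> B N BE e eE vW vS; rewrite -eE in BE *; lia.
have jE : ((2 ^ m.+2 - k).-1.+1 = 2 ^ m.+2 - k)%N by lia.
have jSE : ((2 ^ m.+2 - k).-1.+2 = 2 ^ m.+2 - h.*2)%N by lia.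
have oddj : odd (2 ^ m.+2 - k) by lia.
have [|u] := oddW (2 ^ m.+2 - k).-1; first by rewrite -oddS jE oddj.
rewrite jSE jE => WE.
have j0 : (2 ^ m.+2 - k)%:R != 0 :> int by rewrite pnatr_eq0; lia.
have vj : v2 (2 ^ m.+2 - k)%:R = 0%N.
  by rewrite /v2 natz absz_nat logn_coprime // coprime2n.
have exp2N0 : (2 ^+ m.+1 : int) != 0 by rewrite expf_neq0.
have a0 := mulf_neq0 (mulf_neq0 exp2N0 j0) W0.
(* The main term has valuation at most [2m + 1], below the exponent [2m + 3] of the error. *)
have := v2_add_exp2 _ u (m.+2 + m.+1) a0.
rewrite -WE !v2M ?mulf_neq0 // v2_exp2 vj => -[|W1 vW1]; first by lia.
(* Compared with [h.*2], the coefficient of [W] gains [m + 1] and the lower index gains [d]: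
   together the term [n - 1] for odd [k]. *)
have := valS _ W1; rewrite vW1.
have kN : (2 ^ m.+2 - k + h.*2.+1 = 2 ^ m.+2)%N by lia.
move: (2 ^ m.+2 * _)%N (2 ^ (d + _))%N BE (2 ^ m.+2 - k)%N kN vW.
by move=> B N BE e eE vW vS; rewrite -eE in BE *; lia.
Qed.
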